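(* There exists an absolute constant $C>0$ such that for every finite connected vertex-transitive directed graph $\Gamma$ on $n$ vertices, \[ \overrightarrow{\mathrm{diam}}(\Gamma) \leq C\cdot \mathrm{diam}(\Gamma)^2 (\log n)^2, \] i.e. $\overrightarrow{\mathrm{diam}}(\Gamma) = O(\mathrm{diam}(\Gamma)^2(\log n)^2)$.
   Context: A (directed) graph on a finite vertex set $\Omega$ is a relation $\Gamma\subseteq\Omega\times\Omega$ (loops allowed); $(\alpha,\beta)\in\Gamma$ is a directed edge from $\alpha$ to $\beta$. $\Gamma$ is vertex-transitive if its automorphism group (permutations of $\Omega$ preserving $\Gamma$) acts transitively on $\Omega$. The directed diameter $\overrightarrow{\mathrm{diam}}(\Gamma)$ is the maximum over ordered pairs of vertices $(\alpha,\beta)$ of the length of a shortest path from $\alpha$ to $\beta$ that respects edge orientations. The undirected diameter $\mathrm{diam}(\Gamma)$ is the maximum distance between two vertices when edge orientations are ignored, i.e. $\mathrm{diam}(\Gamma)=\overrightarrow{\mathrm{diam}}(\Gamma\cup\Gamma^* )$ with $\Gamma^*=\{(\beta,\alpha)\mid(\alpha,\beta)\in\Gamma\}$. Connected means that any two vertices are joined by a path ignoring orientations; for finite vertex-transitive directed graphs this is equivalent to strong connectivity, so the directed diameter is finite. $\log$ is the base-2 logarithm. *)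

(* Defs.v *)
From HB Require Import structures.
From mathcomp Require Import all_boot all_order all_algebra all_fingroup.
From mathcomp Require Import reals exp.

Set Implicit Arguments.
Unset Strict Implicit.
Unset Printing Implicit Defensive.

Import Order.TTheory GRing.Theory Num.Theory.

Section Digraph.
Variables (T : finType) (e : rel T).

Definition has_path_of_length (x y : T) (k : nat) : bool :=
  [exists p : k.-tuple T, path e x p && (last x p == y)].

(* A shortest path has no repeated vertex, hence has length less than #|T|.
   If y is not reachable from x, the value is the junk length #|T|; see
   distP and vtrans_connected_strong, which show that this case does not
   occur in connected vertex-transitive digraphs. *)
Definition dist (x y : T) : nat :=
  find (has_path_of_length x y) (iota 0 #|T|).

Definition ddiam : nat := \max_(x : T) \max_(y : T) dist x y.

Definition digraph_aut : {set {perm T}} :=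
  [set s : {perm T} | [forall x, forall y, e (s x) (s y) == e x y]].

Lemma digraph_autP (s : {perm T}) :
  reflect (forall x y, e (s x) (s y) = e x y) (s \in digraph_aut).
Proof.
rewrite inE; apply: (iffP forallP) => [h x y|h x].
  by have /forallP/(_ y)/eqP := h x.
by apply/forallP => y; rewrite h.
Qed.

Lemma digraph_aut_group_set : group_set digraph_aut.
Proof.
apply/group_setP; split; first by apply/digraph_autP => x y; rewrite !perm1.
move=> s t /digraph_autP hs /digraph_autP ht; apply/digraph_autP => x y.
by rewrite !permM ht hs.
Qed.
Canonical digraph_aut_group := Group digraph_aut_group_set.

(* Since atrans requires a nonempty set, the vertex set is nonempty. *)
Definition vertex_transitive : bool :=
  [transitive digraph_aut, on [set: T] | 'P].

(* Gamma \cup Gamma^* *)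
Definition sym_closure : rel T := [rel x y | e x y || e y x].

Definition weakly_connected : Prop := forall x y : T, connect sym_closure x y.

Lemma has_path_of_lengthP (x y : T) (k : nat) :
  reflect (exists p : seq T, [/\ path e x p, last x p = y & size p = k])
          (has_path_of_length x y k).
Proof.
apply: (iffP existsP) => [[p /andP[pp /eqP lp]]|[p [pp lp sp]]].
  by exists p; rewrite size_tuple.
have sp' : size p == k by apply/eqP.
by exists (Tuple sp'); rewrite /= pp lp eqxx.
Qed.

Lemma distP (x y : T) : connect e x y ->
  has_path_of_length x y (dist x y) /\
  (forall p, path e x p -> last x p = y -> dist x y <= size p).
Proof.
move=> /connectP[q pq lq].
have small : has (has_path_of_length x y) (iota 0 #|T|).
  case/shortenP: pq lq => p pp up _ lp.
  apply/hasP; exists (size p); last by apply/has_path_of_lengthP; exists p.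
  by rewrite mem_iota /= add0n; have /= <- := card_uniqP up; apply: max_card.
have lt : dist x y < #|T| by rewrite -[X in _ < X](size_iota 0) -has_find.
split; first by have := nth_find 0 small; rewrite nth_iota.
move=> p pp lp; rewrite leqNgt; apply/negP => h.
have := before_find 0 h; rewrite nth_iota ?(ltn_trans h) // add0n.
by move/has_path_of_lengthP; apply; exists p.
Qed.

Lemma vtrans_connected_strong :
  vertex_transitive -> weakly_connected -> forall x y, connect e x y.
Proof.
move=> tr wc.
have aut_connect s x y : s \in digraph_aut ->
    connect e x y -> connect e (s x) (s y).
  move=> /digraph_autP hs /connectP[p pp ->].
  apply/connectP; exists (map s p); last by rewrite last_map.
  by rewrite path_map; apply: sub_path pp => u v; rewrite /= hs.
have card_reach x y : #|connect e x| <= #|connect e y|.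
  have [s sA ->] := atransP2 tr (in_setT x) (in_setT y).
  rewrite -(card_image (@perm_inj _ s)); apply/subset_leq_card/subsetP => z.
  by case/imageP => u xu ->; apply: aut_connect.
have back x y : e x y -> connect e y x.
  move=> exy; have sub : connect e y \subset connect e x.
    by apply/subsetP => z; apply/connect_trans/connect1.
  have /subset_cardP/(_ sub) h : #|connect e y| = #|connect e x|.
    by apply/eqP; rewrite eqn_leq !card_reach.
  by have := h x; rewrite !inE /in_mem /= connect0.
move=> x y; apply: (connect_sub _ (wc x y)) => u v /orP[/connect1|] //.
exact: back.
Qed.

End Digraph.

Definition diam (T : finType) (e : rel T) : nat := ddiam (sym_closure e).

Definition log2 (R : realType) (x : R) : R := (ln x / ln 2%R)%R.

(* Main.v *)
Require Import Defs.
From HB Require Import structures.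
From mathcomp Require Import all_boot all_order all_algebra all_fingroup.
From mathcomp Require Import reals exp.
From mathcomp Require Import zify.

Set Implicit Arguments.
Unset Strict Implicit.
Unset Printing Implicit Defensive.

Import Order.TTheory GRing.Theory Num.Theory.
Local Open Scope ring_scope.

(** Let [G] be the automorphism group, [d] the undirected diameter, [A] a set
    of vertices and [dA] its directed outer boundary. The number [f u v] of
    [g] in [G] with [g u] in [A] and [g v] outside [A] satisfies the triangle
    inequality, and it is symmetric because [g u] and [g v] are both uniformly
    distributed when [g] is. If [(u, v)] is an edge then [g v] lies in [dA], so
    [f u v <= |G| |dA| / n], and by symmetry the same holds if [(v, u)] is an
    edge. Summing along undirected paths and averaging over the endpoint yields
    [|A| |~A| <= n d |dA|]. Hence directed balls double in size every [2 d]
    steps until they contain more than half of the vertices; an out-ball and an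
    in-ball of that size meet, so the directed diameter is at most
    [4 d log n]. *)

Section Expansion.
Local Open Scope nat_scope.
Variables (T : finType) (e : rel T).
Hypothesis e_trans : vertex_transitive e.
Local Notation G := (digraph_aut e).

(** * Boundaries and orbit counting *)

Definition out_boundary (A : {set T}) : {set T} :=
  [set y | [exists u in A, e u y]] :\: A.

Lemma out_boundaryP (A : {set T}) (u v : T) :
  e u v -> u \in A -> v \notin A -> v \in out_boundary A.
Proof.
by move=> euv uA vA; rewrite !inE vA; apply/existsP; exists u; rewrite uA.
Qed.

Lemma aut_edge (g : {perm T}) (u v : T) : g \in G -> e (g u) (g v) = e u v.
Proof. by move/digraph_autP. Qed.

(** Translation by an automorphism carrying [u] to [v] permutes [G]. *)
Lemma hits_const (S : {set T}) (u v : T) :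
  \sum_(g in G) (g u \in S) = \sum_(g in G) (g v \in S).
Proof.
have [h hG ->] := atransP2 e_trans (in_setT u) (in_setT v).
rewrite (reindex_inj (mulgI h)) /=.
by apply: eq_big => [g|g _]; rewrite ?(groupMl _ hG) //= permM.
Qed.

(** Double counting of pairs [(u, g)] with [g u] in [S]: every [g], being a bijection, contributes
    [#|S|]. *)
Lemma hits_card (S : {set T}) (v : T) :
  #|T| * \sum_(g in G) (g v \in S) = #|G| * #|S|.
Proof.
rewrite -[LHS]sum_nat_const -[RHS]sum_nat_const.
under eq_bigr => u _ do rewrite (hits_const S v u).
rewrite exchange_big /=; apply: eq_bigr => g _.
rewrite -(card_preimset S (@perm_inj _ g)) -sum1_card [RHS]big_mkcond /=.
by apply: eq_bigr => u _; rewrite inE; case: ifP.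
Qed.

(** * Separation counts and the isoperimetric inequality *)

Section Separation.
Variable A : {set T}.

Definition separation (u v : T) : nat :=
  \sum_(g in G) ((g u \in A) && (g v \notin A)).

Lemma separation_triangle (u v w : T) :
  separation u w <= separation u v + separation v w.
Proof.
rewrite -big_split /=; apply: leq_sum => g _.
by case: (g u \in A); case: (g v \in A); case: (g w \in A).
Qed.

Lemma separation_sym (u v : T) : separation u v = separation v u.
Proof.
(* Adding the [g] that send both vertices into [A] turns the two sides into the hit counts of [u]
   and of [v]. *)
apply: (@addnI (\sum_(g in G) ((g u \in A) && (g v \in A)))).
rewrite -!big_split /=.
transitivity (\sum_(g in G) (g u \in A)).
  by apply: eq_bigr => g _; case: (g u \in A); case: (g v \in A).
rewrite (hits_const A u v).
by apply: eq_bigr => g _; case: (g u \in A); case: (g v \in A).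
Qed.

Lemma separation_edge (u v : T) :
  e u v -> #|T| * separation u v <= #|G| * #|out_boundary A|.
Proof.
move=> euv; rewrite -(hits_card (out_boundary A) v) leq_mul2l; apply/orP; right.
apply: leq_sum => g gG; case: andP => [[guA gvA]|_] //.
by rewrite (@out_boundaryP A (g u) (g v)) ?aut_edge.
Qed.

Lemma separation_path (x : T) (p : seq T) :
  path (sym_closure e) x p ->
  #|T| * separation x (last x p) <= size p * (#|G| * #|out_boundary A|).
Proof.
elim: p x => [|y p IHp] x /=.
  by move=> _; rewrite /separation big1 ?muln0 // => g _; rewrite andbN.
case/andP=> exy /IHp le_p; rewrite mulSn.
have le_xy : #|T| * separation x y <= #|G| * #|out_boundary A|.
  by case/orP: exy => /separation_edge //; rewrite separation_sym.
apply: leq_trans (leq_add le_xy le_p).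
by rewrite -mulnDr leq_mul2l separation_triangle orbT.
Qed.

(** Each [g] with [g x] in [A] separates [x] from exactly [#|~: A|] vertices [y]; [hits_card] counts
    such [g]. *)
Lemma sum_separation (x : T) :
  #|T| * \sum_y separation x y = #|G| * #|A| * #|~: A|.
Proof.
rewrite -(hits_card A x) -mulnA; congr (_ * _).
rewrite exchange_big /= big_distrl /=; apply: eq_bigr => g _.
rewrite -(card_preimset (~: A) (@perm_inj _ g)) -sum1_card big_distrr /=.
rewrite [RHS]big_mkcond /=; apply: eq_bigr => y _.
by rewrite !inE; case: (g x \in A); case: (g y \in A).
Qed.

End Separation.

Variable d : nat.
Hypothesis e_diam : forall x y, exists p,
  [/\ path (sym_closure e) x p, last x p = y & size p <= d].

Lemma out_boundary_expansion (A : {set T}) :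
  #|A| * #|~: A| <= #|T| * d * #|out_boundary A|.
Proof.
have [->|[x _]] := set_0Vmem A; first by rewrite cards0.
have G_gt0 : 0 < #|G| by exact: cardG_gt0.
rewrite -(leq_pmul2l G_gt0) mulnA -(sum_separation A x) big_distrr /=.
(* The factor [#|T|] becomes a sum over endpoints [y], to be compared termwise with the path
   bound. *)
have -> : #|G| * (#|T| * d * #|out_boundary A|) =
          \sum_(y : T) d * (#|G| * #|out_boundary A|).
  by rewrite sum_nat_const -mulnA mulnCA (mulnCA #|G|).
apply: leq_sum => y _; have [p [ep <- le_p]] := e_diam x y.
by apply: leq_trans (separation_path A ep) _; rewrite leq_mul2r le_p orbT.
Qed.

(** * Growth of directed balls *)

Definition out_ball (x : T) (k : nat) : {set T} :=
  iter k (fun A => A :|: out_boundary A) [set x].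

Lemma out_ballP (x y : T) (k : nat) : y \in out_ball x k ->
  exists p, [/\ path e x p, last x p = y & size p <= k].
Proof.
elim: k y => [|k IHk] y; first by move/set1P->; exists [::].
rewrite /= !inE => /orP[/IHk[p [ep lp sp]]|].
  by exists p; rewrite ep lp (leqW sp).
case/andP=> _ /existsP[u /andP[/IHk[p [ep lp sp]] euy]].
by exists (rcons p y); rewrite rcons_path ep lp euy last_rcons size_rcons.
Qed.

Lemma card_out_ballS (x : T) (k : nat) :
  #|out_ball x k.+1| = #|out_ball x k| + #|out_boundary (out_ball x k)|.
Proof.
rewrite /= cardsU (_ : _ :&: _ = set0) ?cards0 ?subn0 //.
by apply/setP => y; rewrite !inE; case: (y \in _).
Qed.

Lemma leq_card_out_ball (x : T) (k i : nat) :
  #|out_ball x k| <= #|out_ball x (k + i)|.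
Proof.
elim: i => [|i /leq_trans]; first by rewrite addn0.
by apply; rewrite addnS card_out_ballS leq_addr.
Qed.

Lemma card_out_ball_step (x : T) (k : nat) :
  2 * #|out_ball x k| <= #|T| ->
  #|out_ball x k| <= 2 * d * #|out_boundary (out_ball x k)|.
Proof.
move=> small; have := out_boundary_expansion (out_ball x k).
have T_gt0 : 0 < #|T| by apply/card_gt0P; exists x.
have := cardsC (out_ball x k); set a := #|out_ball x k| in small *.
set b := #|out_boundary _|; set c := #|~: _| => eqT le_b.
(* The complement has at least half of the vertices, whence the factor 2. *)
rewrite -(leq_pmul2l T_gt0); nia.
Qed.

(** Each step adds at least [1/(2d)] of the current ball, hence of the initial one. Clearing
    denominators keeps [d = 0] admissible. *)
Lemma card_out_ball_linear (x : T) (k i : nat) :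
  2 * #|out_ball x (k + i)| <= #|T| ->
  #|out_ball x k| * (2 * d + i) <= 2 * d * #|out_ball x (k + i)|.
Proof.
elim: i => [|i IHi] small; first by rewrite !addn0 mulnC.
have mono := leq_card_out_ball x (k + i) 1.
rewrite addnS in small *; rewrite addn1 in mono.
have small' : 2 * #|out_ball x (k + i)| <= #|T| by lia.
have := IHi small'; have := card_out_ball_step small'.
have := leq_card_out_ball x k i.
by rewrite card_out_ballS; nia.
Qed.

Lemma card_out_ball_double (x : T) (k : nat) :
  2 * #|out_ball x (k + 2 * d)| <= #|T| ->
  2 * #|out_ball x k| <= #|out_ball x (k + 2 * d)|.
Proof.
move=> small; have := card_out_ball_linear small.
(* For [d > 0] the factor [2 * d] cancels; for [d = 0] the step bound forces the ball to have size
   0. *)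
have [d0|d_gt0] := posnP d; last by nia.
have := card_out_ball_step small; rewrite d0 muln0 mul0n addn0 leqn0.
by move/eqP->.
Qed.

Lemma card_out_ball_exp (x : T) (j : nat) :
  (#|T| < 2 * #|out_ball x (2 * d * j)|) || (2 ^ j <= #|out_ball x (2 * d * j)|).
Proof.
elim: j => [|j IHj]; first by rewrite muln0 /= cards1 orbT.
case: ltnP => //= small; rewrite mulnS addnC in small *.
have mono := leq_card_out_ball x (2 * d * j) (2 * d).
have := card_out_ball_double small; rewrite expnS; move: IHj small mono.
move: #|out_ball x (2 * d * j + _)| #|out_ball x _| (2 ^ j) #|T| => b a p n.
(* If the smaller ball already exceeded half, so would the larger one, against [small]. *)
by case/orP; lia.
Qed.

(** With [j = trunc_log 2 #|T|] one has [#|T| < 2 ^ j.+1], so [2 ^ j] vertices are already more than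
    half. *)
Lemma card_out_ball_half (x : T) :
  #|T| < 2 * #|out_ball x (2 * d * trunc_log 2 #|T|)|.
Proof.
have T_gt0 : 0 < #|T| by apply/card_gt0P; exists x.
have /andP[_ ltT] := trunc_log_bounds (isT : 1 < 2) T_gt0.
case/orP: (card_out_ball_exp x (trunc_log 2 #|T|)) => // le2.
by apply: leq_trans ltT _; rewrite expnS leq_mul2l le2 orbT.
Qed.

End Expansion.

(** * From ball growth to the directed diameter *)

Section Diameter.
Local Open Scope nat_scope.
Variables (T : finType) (e : rel T).
Hypotheses (e_trans : vertex_transitive e) (e_conn : weakly_connected e).

(** In-balls are out-balls of the reversed relation, which has the same automorphisms. *)
Lemma vertex_transitive_rev : vertex_transitive (fun x y => e y x).
Proof.
rewrite /vertex_transitive (_ : digraph_aut _ = digraph_aut e) //.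
by apply/setP => s; apply/digraph_autP/digraph_autP => h x y; apply: h.
Qed.

Lemma diam_path (x y : T) : exists p,
  [/\ path (sym_closure e) x p, last x p = y & size p <= diam e].
Proof.
have [/has_path_of_lengthP[p [ep lp sp]] _] := distP (e_conn x y).
exists p; split=> //; rewrite sp.
by apply: leq_trans (leq_bigmax y) (leq_bigmax (F := fun z => _) x).
Qed.

Lemma diam_path_rev (x y : T) : exists p,
  [/\ path (sym_closure (fun x y => e y x)) x p, last x p = y
    & size p <= diam e].
Proof.
have [p [ep lp sp]] := diam_path x y; exists p; split=> //.
by apply: sub_path ep => u v; rewrite /sym_closure /= orbC.
Qed.

Lemma ddiam_le : ddiam e <= 4 * diam e * trunc_log 2 #|T|.
Proof.
apply/bigmax_leqP => x _; apply/bigmax_leqP => y _.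
have out_x := card_out_ball_half e_trans diam_path x.
have in_y := card_out_ball_half vertex_transitive_rev diam_path_rev y.
set k := 2 * diam e * trunc_log 2 #|T| in out_x in_y.
pose A := out_ball e x k; pose B := out_ball (fun x y => e y x) y k.
(* Disjoint sets that each contain more than half of the vertices would be too large together. *)
have /pred0Pn[z /andP[/= zx zy]] : ~~ [disjoint A & B].
  apply/negP => dis; have [_] := leq_card_setU A B; rewrite dis => /eqP cardU.
  have := max_card (A :|: B); rewrite cardU leqNgt => /negP; apply.
  rewrite -(ltn_pmul2l (isT : 0 < 2)) mulnDr {1}mul2n -addnn.
  apply: (@ltn_trans (#|T| + 2 * #|B|)); rewrite (ltn_add2l, ltn_add2r).
    exact: in_y.
  exact: out_x.
have [p [ep lp sp]] := out_ballP zx; have [q [eq lq sq]] := out_ballP zy.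
have [_ min_dist] := distP (vtrans_connected_strong e_trans e_conn x y).
(* [q] leads from [y] to [z] along reversed edges; read backwards, without its starting point [z],
   it continues [p] to [y]. *)
apply: leq_trans (min_dist (p ++ rev (belast y q)) _ _) _.
- by rewrite cat_path ep lp -lq rev_path.
- rewrite last_cat lp -lq; case: (q) => //= a s.
  by rewrite rev_cons last_rcons.
rewrite size_cat size_rev size_belast; apply: leq_trans (leq_add sp sq) _.
by rewrite addnn -mul2n !mulnA.
Qed.

End Diameter.

Lemma trunc_log2_le (R : realType) (n : nat) :
  (0 < n)%N -> (trunc_log 2 n)%:R <= log2 (n%:R : R).
Proof.
move=> n_gt0; have /andP[le_n _] := trunc_log_bounds (isT : (1 < 2)%N) n_gt0.
have ln2_gt0 : 0 < ln (2 : R) by rewrite ln_gt0 // ltr1n.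
rewrite /log2 ler_pdivlMr // mulr_natl -lnXn ?ltr0n //.
by rewrite ler_ln ?posrE ?exprn_gt0 ?ltr0n // -natrX ler_nat.
Qed.

Theorem theorem1p2 (R : realType) :
  exists C : R, 0 < C /\
    forall (T : finType) (e : rel T),
      vertex_transitive e -> weakly_connected e ->
      (ddiam e)%:R <= C * (diam e)%:R ^+ 2 * log2 (#|T|%:R : R) ^+ 2.
Proof.
exists 4; split=> [|T e e_trans e_conn]; first by rewrite ltr0n.
have T_gt0 : (0 < #|T|)%N.
  (* Transitivity presents the full vertex set as the orbit of one of its points. *)
  have /imsetP[x _ _] := e_trans.
  by apply/card_gt0P; exists x.
apply: (@le_trans _ _ (4 * diam e ^ 2 * trunc_log 2 #|T| ^ 2)%:R).
  (* The linear bound is weakened to squares among natural numbers, where [m <= m ^ 2] always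
     holds. *)
  by rewrite ler_nat; apply: leq_trans (ddiam_le e_trans e_conn) _; nia.
rewrite 2!natrM !natrX ler_wpM2l ?mulr_ge0 ?exprn_ge0 ?ler0n //.
by rewrite ler_pXn2r ?nnegrE ?(le_trans _ (trunc_log2_le _ _)) ?trunc_log2_le ?ler0n.
Qed.
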